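(* Let $r \geq 4$ be an integer, and let $G$ be a connected graph on $n$ vertices containing no clique of size $r$. Then $t(G) \geq \frac{\log n}{4 \log r}$, where $t(G)$ denotes the maximum number of vertices in an induced subgraph of $G$ that is a tree.
   Context: All graphs are finite and simple. For a graph $G$, $t(G)$ is the maximum number of vertices of an induced subgraph of $G$ which is a tree. The base of the logarithm is irrelevant since it appears in both numerator and denominator. *)

(* Defs.v *)
From HB Require Import structures.
From mathcomp Require Import all_boot all_order all_algebra.
From mathcomp Require Import boolp reals exp.

Set Implicit Arguments.
Unset Strict Implicit.
Unset Printing Implicit Defensive.

Record sgraph := SGraph {
  vertex :> finType;
  adj : rel vertex;
  adj_sym : symmetric adj;
  adj_irrefl : irreflexive adj
}.

Section Induced.
Variables (G : sgraph) (S : {set G}).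

Definition induced_adj : rel {x : G | x \in S} :=
  fun x y => adj (val x) (val y).

Lemma induced_adj_sym : symmetric induced_adj.
Proof. by move=> x y; exact: adj_sym. Qed.

Lemma induced_adj_irrefl : irreflexive induced_adj.
Proof. by move=> x; exact: adj_irrefl. Qed.

Definition induced : sgraph := SGraph induced_adj_sym induced_adj_irrefl.

End Induced.

Definition is_connected (G : sgraph) : Prop :=
  (0 < #|G|)%N /\ forall x y : G, connect (@adj G) x y.

(* Closed walks of length 2 along a single edge also satisfy ucycle, hence
   the bound on the size. *)
Definition is_acyclic (G : sgraph) : Prop :=
  forall c : seq G, (2 < size c)%N -> ~ ucycle (@adj G) c.

Definition is_tree (G : sgraph) : Prop := is_connected G /\ is_acyclic G.

Definition is_clique (G : sgraph) (S : {set G}) : Prop :=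
  forall x y : G, x \in S -> y \in S -> x != y -> adj x y.

Definition max_induced_tree (G : sgraph) : nat :=
  \max_(S : {set G} | `[< is_tree (induced S) >]) #|S|.

(* Main.v *)
(** By induction on [n = #|S|], every connected [K_r]-free graph [S] contains,
    through each of its vertices [v], an induced tree [T] with
    [n <= r ^ (4 * #|T|)]. Let [A] be the neighbours and [B] the non-neighbours
    of [v], and let [X a], for [a] in [A], be the union of the components of [B]
    that touch [a]. Because [S] is connected, the sets [X a] cover [B].
    - If [n <= r ^ 4], the vertex [v] is enough.
    - If [n <= (#|A| * r) ^ 4], Ramsey's theorem gives a large induced star.
    - If [n <= r ^ 4 * #|X a|], hang a tree of [a |: X a] from [v].
    - If [n <= #|X a :\: X b| * #|X b :\: X a|] for non-adjacent [a] and [b],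
      hang one tree from each of [a] and [b]; no edge joins the two trees.
    Otherwise, order [A] by the size of [X a]: picking greedily the largest
    element and passing to its neighbours gives a clique [K] in [A] such that
    every [X a] is contained in the union of the [X k], [k] in [K], up to fewer
    than [sqrt n] vertices. As [#|K| < r] and [#|A| < n ^ (1/4) / r], the sets
    [X a] are then too small to cover [B]. *)

Require Import Defs.
From mathcomp Require Import all_boot all_order all_algebra.
From mathcomp Require Import boolp reals exp zify.
Import Order.TTheory GRing.Theory Num.Theory.

Set Implicit Arguments.
Unset Strict Implicit.
Unset Printing Implicit Defensive.

Lemma connect_ind (T : finType) (e : rel T) (P : T -> Prop) (x : T) :
  P x -> (forall y z, connect e x y -> P y -> e y z -> P z) ->
  forall y, connect e x y -> P y.
Proof.
move=> Px Pe y /connectP[p + ->].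
elim/last_ind: p => //= p z IHp; rewrite rcons_path last_rcons => /andP[xp pz].
by apply: Pe pz; [apply/connectP; exists p | apply: IHp].
Qed.

Lemma next_exit (T : finType) (c : seq T) (P : pred T) (x y : T) :
  uniq c -> x \in c -> y \in c -> P x -> ~~ P y ->
  exists u, [/\ u \in c, P u & ~~ P (next c u)].
Proof.
move=> Uc xc yc Px; apply: contraNP => no_exit.
have : fconnect (next c) x y by rewrite (fconnect_cycle (cycle_next Uc) xc).
suff stay z : fconnect (next c) x z -> z \in c /\ P z by case/stay.
move: z; apply: connect_ind => // u w _ [uc Pu] /eqP <-.
rewrite mem_next; split=> //; apply/negPn/negP => nPw.
by apply: no_exit; exists u.
Qed.

Lemma next_next_neq (T : finType) (c : seq T) (x : T) :
  uniq c -> 2 < size c -> x \in c -> next c (next c x) != x.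
Proof.
move=> Uc c_gt2 xc; apply/eqP => nnx.
have: order (next c) x <= size [:: x; next c x].
  by apply: order_le_cycle; rewrite ?mem_head //= nnx !eqxx.
by rewrite (order_cycle (cycle_next Uc) Uc xc) leqNgt c_gt2.
Qed.

Lemma leq_expn2r (m n e : nat) : m <= n -> m ^ e <= n ^ e.
Proof. by case: e => // e; rewrite leq_exp2r. Qed.

(* The recurrence [R(k, l) <= R(k - 1, l) + R(k, l - 1)] of Ramsey numbers holds
   for the bound [k ^ l]. *)
Lemma leq_add_expn (k i k1 i1 k2 i2 : nat) :
  k1 < k -> k2 <= k -> i1 <= i.+1 -> i2 <= i ->
  k1.+1 ^ i1 + k2.+1 ^ i2 <= k.+1 ^ i.+1.
Proof.
move=> k1k k2k i1i i2i; rewrite expnS mulSnr; apply: leq_add.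
  apply: leq_trans (leq_pexp2l _ i1i) _ => //.
  by rewrite expnS leq_mul // leq_expn2r // ltnW.
exact: leq_trans (leq_pexp2l _ i2i) (leq_expn2r i (k2k : k2 < k.+1)).
Qed.

Lemma leq_sum_card_mul (I : finType) (A : {set I}) (f : I -> nat) (n : nat) :
  (forall i, i \in A -> #|A| * f i <= n) -> \sum_(i in A) f i <= n.
Proof.
have [A0 _|A_gt0 Af] := posnP #|A|; first by rewrite (cards0_eq A0) big_set0.
by rewrite -(leq_pmul2l A_gt0) big_distrr /= -sum_nat_const; apply: leq_sum.
Qed.

Lemma leq_card_bigcup (T I : finType) (A : {set I}) (F : I -> {set T}) :
  #|\bigcup_(i in A) F i| <= \sum_(i in A) #|F i|.
Proof.
elim/big_rec2: _ => [|i m X _ Xm]; first by rewrite cards0.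
by apply: leq_trans (leq_card_setU _ _) _; rewrite leq_add2l.
Qed.

Section Graph.
Variable G : sgraph.
Implicit Types (A B I K P Q S T U W : {set G}) (a b u v x y : G).

Definition independent S := forall x y, x \in S -> y \in S -> ~~ adj x y.

Definition clique_free (r : nat) := forall K, is_clique K -> #|K| < r.

Definition nbhd A u : {set G} := [set x in A | adj u x].

Definition non_nbhd A u : {set G} := [set x in A :\ u | ~~ adj u x].

Lemma nbhd_sub A u : nbhd A u \subset A.
Proof. by apply/subsetP => x /setIdP[]. Qed.

Lemma non_nbhd_sub A u : non_nbhd A u \subset A.
Proof. by apply/subsetP => x /setIdP[/setD1P[]]. Qed.

Lemma card_nbhdD A u :
  u \in A -> #|A| = (#|nbhd A u| + #|non_nbhd A u|).+1.
Proof.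
move=> uA; rewrite (cardsD1 u) uA -(cardsID [set x | adj u x] (A :\ u)) add1n.
congr (_ + _).+1; apply: eq_card => x; rewrite !inE.
- by case: eqVneq => // ->; rewrite adj_irrefl !andbF.
- by rewrite andbC.
Qed.

Lemma nbhdU1_non_nbhd_proper A u a :
  u \in A -> a \in nbhd A u -> a |: non_nbhd A u \proper A.
Proof.
move=> uA /setIdP[aA ua]; apply/properP; split.
  by rewrite subUset sub1set aA non_nbhd_sub.
exists u; rewrite // !inE eqxx /= orbF.
by apply: contraTneq ua => ->; rewrite adj_irrefl.
Qed.

Lemma nbhd_proper A u : u \in A -> nbhd A u \proper A.
Proof.
move=> uA; apply/properP; split; first exact: nbhd_sub.
by exists u; rewrite // inE adj_irrefl andbF.
Qed.

Lemma clique1 u : is_clique [set u].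
Proof. by move=> x y /set1P -> /set1P ->; rewrite eqxx. Qed.

Lemma clique_free_gt1 (r : nat) v : clique_free r -> 1 < r.
Proof. by move/(_ [set v] (clique1 (u := v))); rewrite cards1. Qed.

Lemma cliqueS K T : K \subset T -> is_clique T -> is_clique K.
Proof. by move=> /subsetP KT cT x y /KT xT /KT yT; apply: cT. Qed.

Lemma clique_nbhdU1 A K u :
  is_clique K -> K \subset nbhd A u -> is_clique (u |: K).
Proof.
move=> cK /subsetP KN.
have uK x : x \in K -> adj u x by move/KN/setIdP=> [].
move=> x y /setU1P[->|xK] /setU1P[->|yK]; first by rewrite eqxx.
- by rewrite uK.
- by rewrite adj_sym uK.
- exact: cK.
Qed.

Lemma independent_non_nbhdU1 A I u :
  independent I -> I \subset non_nbhd A u -> independent (u |: I).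
Proof.
move=> indI /subsetP IM.
have uI x : x \in I -> ~~ adj u x by move/IM/setIdP=> [].
move=> x y /setU1P[->|xI] /setU1P[->|yI]; first by rewrite adj_irrefl.
- exact: uI.
- by rewrite adj_sym uI.
- exact: indI.
Qed.

Lemma card_nbhdU1 A K u : K \subset nbhd A u -> #|u |: K| = #|K|.+1.
Proof.
move=> KN; rewrite cardsU1 (contra (subsetP KN u)) //.
by rewrite inE adj_irrefl andbF.
Qed.

Lemma card_non_nbhdU1 A I u : I \subset non_nbhd A u -> #|u |: I| = #|I|.+1.
Proof.
by move=> IM; rewrite cardsU1 (contra (subsetP IM u)) // !inE eqxx.
Qed.

Lemma ramsey A :
  exists K I, [/\ is_clique K, independent I, K \subset A, I \subset A
                & #|A| < #|K|.+1 ^ #|I|].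
Proof.
have [m] := ubnP #|A|; elim: m A => // m IHm A Am.
have [->|[u uA]] := set_0Vmem A.
  by exists set0, set0; rewrite !cards0; split=> // x y; rewrite inE.
have cardA := card_nbhdD uA.
have [|K1 [I1 [cK1 indI1 K1N I1N N_lt]]] := IHm (nbhd A u); first by lia.
have [|K2 [I2 [cK2 indI2 K2M I2M M_lt]]] := IHm (non_nbhd A u); first by lia.
have [K [cK KA K1K K2K]] :
    exists K, [/\ is_clique K, K \subset A, #|K1| < #|K| & #|K2| <= #|K|].
  have cardK1 := card_nbhdU1 K1N.
  have [le21|lt12] := leqP #|K2| #|K1|.+1.
    exists (u |: K1); rewrite cardK1; split=> //.
      exact: clique_nbhdU1 K1N.
    by rewrite subUset sub1set uA (subset_trans K1N) ?nbhd_sub.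
  by exists K2; split=> //; [apply: subset_trans (non_nbhd_sub A u) | lia].
have [I [indI IA I1I I2I]] :
    exists I, [/\ independent I, I \subset A, #|I1| <= #|I| & #|I2| < #|I|].
  have cardI2 := card_non_nbhdU1 I2M.
  have [le12|lt21] := leqP #|I1| #|I2|.+1.
    exists (u |: I2); rewrite cardI2; split=> //.
      exact: independent_non_nbhdU1 I2M.
    by rewrite subUset sub1set uA (subset_trans I2M) ?non_nbhd_sub.
  by exists I1; split=> //; [apply: subset_trans (nbhd_sub A u) | lia].
exists K, I; split=> //.
have i_gt0 : 0 < #|I| by apply: leq_ltn_trans I2I.
rewrite -(prednK i_gt0) in I1I I2I *.
have := leq_add_expn K1K K2K I1I I2I.
by rewrite cardA; lia.
Qed.

(* Greedily pick an element where [f] is largest and pass to its neighbours. *)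
Lemma dominating_clique A (f : G -> nat) :
  exists K, [/\ is_clique K, K \subset A &
    forall a, a \in A -> exists k, [/\ k \in K, ~~ adj a k & f a <= f k]].
Proof.
have [m] := ubnP #|A|; elim: m A => // m IHm A Am.
have [->|[a0 a0A]] := set_0Vmem A.
  by exists set0; split=> // [x y|a]; rewrite inE.
have [u uA umax] : exists2 u, u \in A & forall a, a \in A -> f a <= f u.
  by case: (arg_maxnP f a0A) => u; exists u.
have [|K [cK KN domK]] := IHm (nbhd A u).
  by have := proper_card (nbhd_proper uA); lia.
exists (u |: K); split.
- exact: clique_nbhdU1 KN.
- by rewrite subUset sub1set uA (subset_trans KN) ?nbhd_sub.
move=> a aA; have [ua|nua] := boolP (adj u a).
  have [|k [kK nak fak]] := domK a; first by rewrite inE aA.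
  by exists k; rewrite setU1r.
by exists u; rewrite setU11 adj_sym nua umax.
Qed.

(* If the two differences of [X a] and [X b] have a small product, then the
   difference of the smaller set with the larger one is small. *)
Lemma clique_absorbs (V : finType) A (X : G -> {set V}) (n : nat) :
  (forall a b, a \in A -> b \in A -> ~~ adj a b ->
     #|X a :\: X b| * #|X b :\: X a| < n) ->
  exists K, [/\ is_clique K, K \subset A &
    forall a, a \in A -> #|X a :\: \bigcup_(k in K) X k| ^ 2 < n].
Proof.
move=> smallX; have [K [cK KA domK]] := dominating_clique A (fun a => #|X a|).
exists K; split=> // a aA; have [k [kK nak le_ak]] := domK a aA.
apply: leq_ltn_trans (smallX a k aA (subsetP KA k kK) nak); rewrite -mulnn.
have le_sub : #|X a :\: \bigcup_(k in K) X k| <= #|X a :\: X k|.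
  by apply/subset_leq_card/setDS/bigcup_sup.
apply: leq_mul le_sub (leq_trans le_sub _).
by rewrite !cardsD [X k :&: _]setIC leq_sub2r.
Qed.

Lemma large_set_or_pair (V : finType) A (X : G -> {set V}) (r n : nat) :
  1 < r -> clique_free r -> r ^ 4 < n -> (#|A| * r) ^ 4 < n ->
  n <= (#|A| + #|\bigcup_(a in A) X a|).+1 ->
  (exists2 a, a \in A & n <= r ^ 4 * #|X a|) \/
  (exists a b, [/\ a \in A, b \in A, ~~ adj a b
                 & n <= #|X a :\: X b| * #|X b :\: X a|]).
Proof.
move=> r_gt1 freeG r4_lt A_lt n_le; apply: contrapT => /not_orP[no_set no_pair].
have [a b aA bA nab|K [cK KA absorbK]] := @clique_absorbs V A X n.
  by rewrite ltnNge; apply/negP => n_ab; apply: no_pair; exists a, b.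
set Z := \bigcup_(k in K) X k in absorbK.
have cover : \bigcup_(a in A) X a \subset Z :|: \bigcup_(a in A) (X a :\: Z).
  apply/bigcupsP => a aA; rewrite -subDset.
  exact: (bigcup_sup a (F := fun a => X a :\: Z)).
have cover_le : #|\bigcup_(a in A) X a| <=
    \sum_(k in K) #|X k| + \sum_(a in A) #|X a :\: Z|.
  apply: leq_trans (subset_leq_card cover) _.
  by apply: leq_trans (leq_card_setU _ _) (leq_add _ _); apply: leq_card_bigcup.
have clique_sum : r ^ 3 * \sum_(k in K) #|X k| <= n.
  rewrite big_distrr /=; apply: leq_sum_card_mul => k kK.
  apply: leq_trans (_ : r ^ 4 * #|X k| <= n); last first.
    rewrite leqNgt; apply/negP => n_lt; apply: no_set; exists k.
      exact: (subsetP KA).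
    exact: ltnW.
  by rewrite mulnA expnS leq_mul // leq_mul // ltnW ?freeG.
have rest_sum : r * \sum_(a in A) #|X a :\: Z| <= n.
  rewrite big_distrr /=; apply: leq_sum_card_mul => a aA.
  rewrite mulnA -leq_sqr expnMn -[n ^ 2]mulnn leq_mul ?(ltnW (absorbK a aA)) //.
  apply: leq_trans (ltnW A_lt); rewrite leq_pexp2l // muln_gt0 (ltnW r_gt1).
  by rewrite andbT; apply/card_gt0P; exists a.
have A_small : 16 * #|A| <= n.
  apply: leq_trans (ltnW A_lt); rewrite expnMn mulnC leq_mul //.
    by case: #|A| => // m; rewrite leq_pmulr ?expn_gt0.
  exact: leq_expn2r 4 r_gt1.
(* [n <= 1 + n / 16 + n / 8 + n / 2 < n], since [2 <= r] *)
have n_gt16 : 16 < n := leq_ltn_trans (leq_expn2r 4 r_gt1) r4_lt.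
have := leq_mul (leq_expn2r 3 r_gt1) (leqnn (\sum_(k in K) #|X k|)).
have := leq_mul r_gt1 (leqnn (\sum_(a in A) #|X a :\: Z|)).
by lia.
Qed.

Definition adj_in S : rel G := fun x y => [&& x \in S, y \in S & adj x y].

Definition rooted S v := v \in S /\ forall x, x \in S -> connect (adj_in S) v x.

Definition acyclic_set S :=
  forall c : seq G, 2 < size c -> ucycle (@adj G) c -> ~ {subset c <= S}.

Definition rooted_tree S v := rooted S v /\ acyclic_set S.

Lemma adj_in_sym S : symmetric (adj_in S).
Proof. by move=> x y; rewrite /adj_in adj_sym andbCA. Qed.

Lemma connect_adj_inS S T x y :
  S \subset T -> connect (adj_in S) x y -> connect (adj_in T) x y.
Proof.
move=> /subsetP ST; apply: connect_sub => u w /and3P[uS wS uw].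
by apply: connect1; rewrite /adj_in !ST.
Qed.

Definition bridge S T x y :=
  [/\ [disjoint S & T], x \in S, y \in T &
      forall s t, s \in S -> t \in T -> adj s t = (s == x) && (t == y)].

Definition anticomplete S T :=
  [disjoint S & T] /\ forall s t, s \in S -> t \in T -> ~~ adj s t.

Lemma bridge_sym S T x y : bridge S T x y -> bridge T S y x.
Proof.
move=> [dST xS yT ST]; split; rewrite 1?disjoint_sym // => t s tT sS.
by rewrite adj_sym ST // andbC.
Qed.

Lemma anticompleteS S T S' T' :
  S' \subset S -> T' \subset T -> anticomplete S T -> anticomplete S' T'.
Proof.
move=> S'S T'T [dST nST]; split; first exact: disjointW S'S T'T dST.
by move=> s t /(subsetP S'S) sS /(subsetP T'T); apply: nST.
Qed.

Lemma bridge_setUl S S' T x y :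
  bridge S T x y -> anticomplete S' T -> bridge (S :|: S') T x y.
Proof.
move=> [dST xS yT ST] [dST' nST]; split=> //.
- by rewrite -setI_eq0 setIUl setU_eq0 !setI_eq0 dST.
- by rewrite inE xS.
move=> s t /setUP[sS|sS'] tT; first exact: ST.
rewrite (negbTE (nST s t sS' tT)); symmetry.
apply: contraTF tT => /andP[/eqP sx _].
by have := nST s y sS' yT; rewrite sx ST // !eqxx.
Qed.

Lemma card_bridge S T x y : bridge S T x y -> #|S :|: T| = #|S| + #|T|.
Proof. by case=> dST _ _ _; apply/eqP; rewrite (leq_card_setU S T).2. Qed.

Lemma rooted_bridge S T v x y :
  rooted S v -> rooted T y -> bridge S T x y -> rooted (S :|: T) v.
Proof.
move=> [vS vconn] [yT yconn] [_ xS _ ST]; split; first by rewrite inE vS.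
have vx : connect (adj_in (S :|: T)) v x.
  exact: connect_adj_inS (subsetUl _ _) (vconn x xS).
have xy : adj_in (S :|: T) x y by rewrite /adj_in !inE xS yT orbT ST // !eqxx.
move=> z /setUP[zS|zT].
  exact: connect_adj_inS (subsetUl _ _) (vconn z zS).
apply: connect_trans (connect_trans vx (connect1 xy)) _.
exact: connect_adj_inS (subsetUr _ _) (yconn z zT).
Qed.

Lemma cycle_exit_bridge S T x y (c : seq G) :
  bridge S T x y -> ucycle (@adj G) c -> {subset c <= S :|: T} ->
  ~ {subset c <= S} -> ~ {subset c <= T} -> x \in c /\ next c x = y.
Proof.
move=> [_ _ _ ST] /andP[cC Uc] cST cS cT.
have /allPn[t tc tS] : ~~ all (mem S) c by apply/negP => /allP.
have /allPn[s sc sT] : ~~ all (mem T) c by apply/negP => /allP.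
have inS z : z \in c -> z \notin T -> z \in S.
  by move=> /cST /setUP[//|zT]; rewrite zT.
have [u [uc uS nuS]] := next_exit (P := mem S) Uc sc tc (inS s sc sT) tS.
have nuT : next c u \in T.
  have := cST (next c u); rewrite mem_next => /(_ uc) /setUP[zS|//].
  by rewrite /= zS in nuS.
have := ST u _ uS nuT; rewrite (next_cycle cC uc).
move=> /esym/andP[/eqP ux /eqP uy].
by rewrite -ux.
Qed.

(* A cycle meeting both sides would have to cross the bridge once in each
   direction, hence consist of these two crossings only. *)
Lemma acyclic_bridge S T x y :
  acyclic_set S -> acyclic_set T -> bridge S T x y -> acyclic_set (S :|: T).
Proof.
move=> acS acT bST c c_gt2 Uc cST.
have cS : ~ {subset c <= S} := acS c c_gt2 Uc.
have cT : ~ {subset c <= T} := acT c c_gt2 Uc.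
have [xc nxy] := cycle_exit_bridge bST Uc cST cS cT.
rewrite setUC in cST.
have [_ nyx] := cycle_exit_bridge (bridge_sym bST) Uc cST cT cS.
have /andP[_ uniq_c] := Uc.
by have := next_next_neq uniq_c c_gt2 xc; rewrite nxy nyx eqxx.
Qed.

Lemma rooted_tree_bridge S T v x y :
  rooted_tree S v -> rooted_tree T y -> bridge S T x y ->
  rooted_tree (S :|: T) v.
Proof.
move=> [rS acS] [rT acT] bST; split; first exact: rooted_bridge bST.
exact: acyclic_bridge bST.
Qed.

Lemma rooted_tree1 v : rooted_tree [set v] v.
Proof.
split; first by split; [rewrite inE | move=> x /set1P ->].
move=> c c_gt2 /andP[_ Uc] cv.
have : size c <= size [:: v].
  by apply: uniq_leq_size Uc _ => x /cv; rewrite !inE.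
by rewrite leqNgt (ltn_trans _ c_gt2).
Qed.

Lemma bridge_nbhd S T v a :
  a \in nbhd S v -> a \in T -> T \subset a |: non_nbhd S v ->
  bridge [set v] T v a.
Proof.
move=> /setIdP[_ va] aT /subsetP TM.
have neq_va : v != a by apply: contraTneq va => <-; rewrite adj_irrefl.
split; rewrite ?set11 //.
  rewrite disjoints1; apply/negP => /TM.
  by rewrite !inE eqxx (negbTE neq_va).
move=> s t /set1P-> /TM /setU1P[->|/setIdP[_ nvt]]; rewrite eqxx ?va ?eqxx //=.
by rewrite (negbTE nvt); symmetry; apply: contraNF nvt => /eqP->.
Qed.

Lemma rooted_tree_star S I v :
  independent I -> I \subset nbhd S v -> rooted_tree (v |: I) v.
Proof.
have [m] := ubnP #|I|; elim: m I => // m IHm I Im indI IN.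
have [->|[x xI]] := set_0Vmem I; first by rewrite setU0; apply: rooted_tree1.
have subI : I :\ x \subset I := subD1set I x.
have -> : v |: I = (v |: I :\ x) :|: [set x].
  by rewrite -setUA [_ :|: [set x]]setUC setD1K.
apply: (@rooted_tree_bridge _ _ v v x); last apply: bridge_setUl.
- apply: IHm; [by move: Im; rewrite (cardsD1 x) xI | | exact: subset_trans IN].
  by move=> a b /(subsetP subI) aI /(subsetP subI); apply: indI.
- exact: rooted_tree1.
- by apply: bridge_nbhd (subsetP IN x xI) _ _; rewrite ?set11 ?subsetUl.
- split; first by rewrite disjoint_sym disjoints1 !inE eqxx.
  by move=> s t /(subsetP subI) sI /set1P ->; apply: indI.
Qed.

(* The union of the components of [B] that touch [a], if [a] is not in [B]. *)
Definition reach B a : {set G} :=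
  [set b in B | connect (adj_in (a |: B)) a b].

Lemma reach_sub B a : reach B a \subset B.
Proof. by apply/subsetP => b /setIdP[]. Qed.

Lemma adj_reach B a b : adj a b -> b \in B -> b \in reach B a.
Proof.
by move=> ab bB; rewrite inE bB connect1 // /adj_in setU11 setU1r.
Qed.

Lemma reach_closed B a : closed (adj_in B) (reach B a).
Proof.
apply: intro_closed; first exact/sym_connect_sym/adj_in_sym.
move=> x y xy /setIdP[_ ax]; have /and3P[xB yB xadjy] := xy.
rewrite inE yB; apply: connect_trans ax (connect1 _).
by rewrite /adj_in !setU1r.
Qed.

Lemma rooted_reach B W a :
  closed (adj_in B) W -> rooted (a |: reach B a :\: W) a.
Proof.
move=> Wcl; split; first exact: setU11.
set Y := a |: _ => x xY.
have ax : connect (adj_in (a |: B)) a x.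
  by move: xY => /setU1P[->|/setDP[/setIdP[]]] //; apply: connect0.
move: x ax xY; apply: connect_ind => [_|u w au IHu /and3P[uaB _ uw] wY].
  exact: connect0.
have [->|neq_wa] := eqVneq w a; first exact: connect0.
have [wB wW] : w \in B /\ w \notin W.
  by move: wY; rewrite !inE (negbTE neq_wa) /= => /andP[-> /andP[->]].
suff uY : u \in Y.
  by apply: connect_trans (IHu uY) (connect1 _); rewrite /adj_in uY wY.
have [->|neq_ua] := eqVneq u a; first exact: setU11.
have uB : u \in B by move: uaB; rewrite in_setU1 (negbTE neq_ua).
have uwB : adj_in B u w by rewrite /adj_in uB wB.
by rewrite setU1r // in_setD (Wcl u w uwB) wW inE uB.
Qed.

Lemma anticomplete_reach B a b :
  a \notin B -> b \notin B -> a != b -> ~~ adj a b ->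
  anticomplete (a |: reach B a :\: reach B b) (b |: reach B b :\: reach B a).
Proof.
move=> aB bB neq_ab nab.
split.
  rewrite disjoints_subset subUset sub1set !inE (negbTE neq_ab).
  rewrite (contraNN _ aB) /=; last by case/and3P.
  apply/subsetP => z zab.
  have zB : z \in B by case/setDP: zab => /(subsetP (reach_sub B a)).
  rewrite in_setC in_setU1 negb_or (contraNneq _ bB) => [|<-//].
  by move: zab; rewrite !in_setD; case: (z \in reach B a); rewrite ?andbF.
move=> s t /setU1P[->|/setDP[sa sb]] /setU1P[->|/setDP[tb ta]] //.
- by apply: contra ta => /adj_reach->; rewrite // (subsetP (reach_sub B b)).
- apply: contra sb; rewrite adj_sym => /adj_reach->; rewrite //.
  exact: (subsetP (reach_sub B a)).
apply: contra sb => st.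
have stB : adj_in B s t.
  by rewrite /adj_in (subsetP (reach_sub B a)) ?(subsetP (reach_sub B b)).
by rewrite (reach_closed b stB).
Qed.

Lemma reach_cover S v :
  rooted S v ->
  non_nbhd S v \subset \bigcup_(a in nbhd S v) reach (non_nbhd S v) a.
Proof.
move=> [_ vconn]; set B := non_nbhd S v; apply/subsetP => b bB.
have /vconn vb : b \in S by apply: subsetP bB; apply: non_nbhd_sub.
move: b vb bB; apply: connect_ind => [|u w _ IHu /and3P[uS _ uw] wB].
  by rewrite !inE eqxx.
have [uN|uN] := boolP (u \in nbhd S v).
  by apply/bigcupP; exists u => //; apply: adj_reach.
have uB : u \in B.
  move: uN wB; rewrite !inE uS /= => ->; rewrite andbT => /andP[_ nvw].
  by rewrite andbT; apply: contraNneq nvw => <-.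
have /bigcupP[a aN ua] := IHu uB; apply/bigcupP; exists a => //.
by have /(_ u w) <- := @reach_closed B a; rewrite // /adj_in uB wB.
Qed.

Section LargeTree.
Variable r : nat.

(* For [0 < m] and [1 < r], the bound says that [T] has at least
   [log m / (4 log r)] vertices. *)
Definition has_tree S v (m : nat) :=
  exists T, [/\ rooted_tree T v, T \subset S & m <= r ^ (4 * #|T|)].

Lemma has_treeS S S' v m m' :
  S \subset S' -> m' <= m -> has_tree S v m -> has_tree S' v m'.
Proof.
move=> SS' m'm [T [rT TS mT]]; exists T; split=> //.
- exact: subset_trans SS'.
- exact: leq_trans mT.
Qed.

Lemma has_tree1 S v : v \in S -> has_tree S v (r ^ 4).
Proof.
move=> vS; exists [set v]; rewrite sub1set cards1; split=> //.
exact: rooted_tree1.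
Qed.

Lemma has_tree_star S v :
  clique_free r -> v \in S -> has_tree S v ((#|nbhd S v| * r) ^ 4).
Proof.
move=> freeG vS; have [K [I [cK indI _ IN card_lt]]] := ramsey (nbhd S v).
have I_ge : #|nbhd S v| <= r ^ #|I|.
  exact: leq_trans (ltnW card_lt) (leq_expn2r _ (freeG K cK)).
exists (v |: I); split; first exact: rooted_tree_star IN.
- by rewrite subUset sub1set vS (subset_trans IN) ?nbhd_sub.
- by rewrite (card_nbhdU1 IN) [4 * _]mulnC expnM leq_expn2r // expnSr leq_mul.
Qed.

Lemma has_tree_hang S v a m :
  v \in S -> a \in nbhd S v -> has_tree (a |: non_nbhd S v) a m ->
  has_tree S v (r ^ 4 * m).
Proof.
move=> vS aN [T [rT TM mT]]; have aT : a \in T by case: rT => -[].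
have vT := bridge_nbhd aN aT TM.
exists (v |: T); split.
- exact: rooted_tree_bridge (rooted_tree1 v) rT vT.
- rewrite subUset sub1set vS (subset_trans TM) //.
  exact/proper_sub/nbhdU1_non_nbhd_proper.
- by rewrite (card_bridge vT) cards1 mulnS expnD leq_mul.
Qed.

Lemma has_tree_hang2 S P Q v a b m1 m2 :
  v \in S -> a \in nbhd S v -> b \in nbhd S v ->
  P \subset a |: non_nbhd S v -> Q \subset b |: non_nbhd S v ->
  anticomplete P Q -> has_tree P a m1 -> has_tree Q b m2 ->
  has_tree S v (r ^ 4 * (m1 * m2)).
Proof.
move=> vS aN bN PM QM antiPQ [T [rT TP mT]] [U [rU UQ mU]].
have vT : bridge [set v] T v a.
  by apply: bridge_nbhd aN _ (subset_trans TP PM); case: rT => -[].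
have vTU : bridge (v |: T) U v b.
  apply: bridge_setUl; last exact: anticompleteS antiPQ.
  by apply: bridge_nbhd bN _ (subset_trans UQ QM); case: rU => -[].
have sub c : c \in nbhd S v -> c |: non_nbhd S v \subset S.
  by move=> cN; apply/proper_sub/nbhdU1_non_nbhd_proper.
exists (v |: T :|: U); split.
- apply: rooted_tree_bridge rU vTU.
  exact: rooted_tree_bridge (rooted_tree1 v) rT vT.
- rewrite !subUset sub1set vS (subset_trans TP) ?(subset_trans PM) ?sub //=.
  by rewrite (subset_trans UQ) ?(subset_trans QM) ?sub.
- rewrite (card_bridge vTU) (card_bridge vT) cards1 !mulnDr 2!expnD muln1 mulnA.
  exact: leq_mul (leq_mul (leqnn _) mT) mU.
Qed.

Lemma has_tree_rooted S v :
  clique_free r -> rooted S v -> has_tree S v #|S|.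
Proof.
move=> freeG; have [k] := ubnP #|S|; elim: k S v => // k IHk S v Sk rS.
have vS : v \in S by case: rS.
have r_gt1 := clique_free_gt1 v freeG.
have [small|r4_lt] := leqP #|S| (r ^ 4).
  exact: has_treeS (subxx S) small (has_tree1 vS).
have [star|A_lt] := leqP #|S| ((#|nbhd S v| * r) ^ 4).
  exact: has_treeS (subxx S) star (has_tree_star freeG vS).
set A := nbhd S v in A_lt; pose B := non_nbhd S v; pose X := reach B.
have aB a : a \in A -> a \notin B by rewrite !inE => /andP[_ ->]; rewrite andbF.
have sub_aB a W : a |: X a :\: W \subset a |: B.
  exact/setUS/(subset_trans (subsetDl _ _))/reach_sub.
have recur a W : a \in A -> closed (adj_in B) W ->
    has_tree (a |: X a :\: W) a #|X a :\: W|.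
  move=> aA Wcl; apply: has_treeS (subxx _) _ (IHk _ a _ (rooted_reach a Wcl)).
    exact/subset_leq_card/subsetUr.
  apply: leq_trans (proper_card _) Sk.
  exact: sub_proper_trans (sub_aB a W) (nbhdU1_non_nbhd_proper vS aA).
have [|[a aA n_le]|[a [b [aA bA nab n_le]]]] :=
    @large_set_or_pair G A X r #|S| r_gt1 freeG r4_lt A_lt.
- rewrite (card_nbhdD vS) ltnS leq_add2l.
  exact: subset_leq_card (reach_cover rS).
- apply: has_treeS (subxx S) n_le (has_tree_hang vS aA _).
  rewrite -(setD0 (X a)); apply: has_treeS (sub_aB a set0) (leqnn _) _.
  by apply: recur => // x y _; rewrite !inE.
have neq_ab : a != b.
  apply: contraTneq n_le => ->.
  by rewrite setDv cards0 -ltnNge (leq_ltn_trans _ r4_lt).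
have anti := anticomplete_reach (aB a aA) (aB b bA) neq_ab nab.
apply: has_treeS (subxx S) _ (has_tree_hang2 vS aA bA (sub_aB a _) (sub_aB b _)
  anti (recur a _ aA (reach_closed b)) (recur b _ bA (reach_closed a))).
by apply: leq_trans n_le (leq_pmull _ _); rewrite expn_gt0 ltnW.
Qed.

End LargeTree.

Lemma connect_induced T x y (xT : x \in T) (yT : y \in T) :
  connect (adj_in T) x y ->
  connect (@adj (induced T)) (exist _ x xT) (exist _ y yT).
Proof.
move=> xy; move: y xy yT; apply: connect_ind => [xT'|u w _ IHu]; last first.
  move=> /and3P[uT _ uw] wT; apply: connect_trans (IHu uT) (connect1 _).
  exact: uw.
by rewrite (bool_irrelevance xT' xT).
Qed.

Lemma rooted_connected_induced T v : rooted T v -> is_connected (induced T).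
Proof.
move=> [vT vconn]; split; first by apply/card_gt0P; exists (exist _ v vT).
move=> [x xT] [y yT]; apply: connect_trans (connect_induced vT yT (vconn y yT)).
rewrite (sym_connect_sym (@adj_sym (induced T))).
exact: connect_induced (vconn x xT).
Qed.

Lemma acyclic_induced T : acyclic_set T -> is_acyclic (induced T).
Proof.
move=> acT c c_gt2 /andP[cC Uc]; apply: (acT (map val c)).
- by rewrite size_map.
- by rewrite /ucycle cycle_map cC map_inj_uniq //; apply: val_inj.
- by move=> x /mapP[y _ ->]; apply: valP.
Qed.

Lemma rooted_tree_le_max T v : rooted_tree T v -> #|T| <= max_induced_tree G.
Proof.
move=> [rT acT]; apply: leq_bigmax_cond; apply/asboolP; split.
- exact: rooted_connected_induced rT.
- exact: acyclic_induced.
Qed.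

Lemma connected_rooted v : is_connected G -> rooted [set: G] v.
Proof.
move=> [_ conn]; split=> [|x _]; rewrite ?inE //.
apply: connect_sub (conn v x) => a b ab.
by apply: connect1; rewrite /adj_in !inE.
Qed.

Lemma no_clique_clique_free (r : nat) :
  ~ (exists K, is_clique K /\ #|K| = r) -> clique_free r.
Proof.
move=> noK K cK; rewrite ltnNge; apply/negP => /card_geqP[s [Us sizes sK]].
apply: noK; exists [set x in s]; rewrite cardsE (card_uniqP Us); split=> //.
by apply: cliqueS cK; apply/subsetP => x; rewrite inE => /sK.
Qed.

Lemma card_le_max_induced_tree (r : nat) :
  is_connected G -> clique_free r -> #|G| <= r ^ (4 * max_induced_tree G).
Proof.
move=> conn freeG; have [/card_gt0P[v _] _] := conn.
have [T [rT _]] := has_tree_rooted freeG (connected_rooted v conn).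
rewrite cardsT => /leq_trans; apply; rewrite leq_pexp2l //.
  exact/ltnW/clique_free_gt1.
by rewrite leq_mul2l (rooted_tree_le_max rT).
Qed.

End Graph.

Local Open Scope ring_scope.

Theorem theorem1p2 (R : realType) (r n : nat) (G : sgraph)
    (hr : (4 <= r)%N) (hn : #|G| = n) (hconn : is_connected G)
    (hclique : ~ exists S : {set G}, is_clique S /\ #|S| = r) :
  ln (n%:R : R) / (4 * ln (r%:R : R)) <= (max_induced_tree G)%:R.
Proof.
have n_gt0 : (0 < n)%N by rewrite -hn; case: hconn.
have r_gt1 : 1 < r%:R :> R by rewrite ltr1n; lia.
have r_gt0 : 0 < r%:R :> R by apply: lt_trans r_gt1.
rewrite ler_pdivrMr; last by rewrite mulr_gt0 // ln_gt0.
rewrite mulrA -natrM mulrC mulr_natr mulnC -lnXn //.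
rewrite ler_ln ?posrE ?exprn_gt0 // ?ltr0n //.
rewrite -natrX ler_nat -hn.
exact: card_le_max_induced_tree (no_clique_clique_free hclique).
Qed.
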